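(* There exist path-connected topological spaces $E$ and $B$, two-fold covering maps $p:E\to B$ and $q:E\to B$, and a point $e_0\in E$ with $p(e_0)=q(e_0)=:b_0$, such that $$p_*\big(\pi_1(E,e_0)\big)=q_*\big(\pi_1(E,e_0)\big)\subseteq \pi_1(B,b_0),$$ but $p$ and $q$ are not equivalent, i.e. there is no homeomorphism $h:E\to E$ with $q\circ h=p$.
   Context: A two-fold covering map is a covering map each of whose fibers has exactly two points. No local path-connectedness is assumed of $E$ or $B$. Here $p_*$ and $q_*$ denote the homomorphisms induced on fundamental groups. *)

(* Defs.v *)
From HB Require Import structures.
From mathcomp Require Import all_boot all_order all_algebra generic_quotient.
From mathcomp Require Import lra.
From mathcomp Require Import all_classical reals topology normedtype homotopy.

Set Implicit Arguments.
Unset Strict Implicit.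
Unset Printing Implicit Defensive.

Import Order.TTheory GRing.Theory Num.Theory.
Import numFieldNormedType.Exports.

Local Open Scope classical_set_scope.
Local Open Scope ring_scope.
Local Open Scope quotient_scope.

Definition unit_interval (R : realType) : Type :=
  set_type ([set` `[0%R, 1%R]] : set R).

HB.instance Definition _ (R : realType) :=
  Topological.copy (unit_interval R) (set_type ([set` `[0%R, 1%R]] : set R)).

Section UnitInterval.
Context {R : realType}.
Local Notation I := (unit_interval R).

Definition uval (t : I) : R := set_val t.

Lemma clamp_subproof (r : R) :
  Num.max 0 (Num.min 1 r) \in ([set` `[0%R, 1%R]] : set R).
Proof.
rewrite inE /= in_itv /= le_max lexx /= ge_max ler01 /=.
by rewrite ge_min lexx.
Qed.

(* The retraction of the real line onto [0, 1]. *)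
Definition clamp (r : R) : I :=
  exist (fun x => x \in ([set` `[0%R, 1%R]] : set R)) _ (clamp_subproof r).

Lemma uval_ge0 t : 0 <= uval t.
Proof.
by case: t => r r01; have := set_mem r01; rewrite /= in_itv /= => /andP[].
Qed.

Lemma uval_le1 t : uval t <= 1.
Proof.
by case: t => r r01; have := set_mem r01; rewrite /= in_itv /= => /andP[].
Qed.

Lemma uval_inj : injective uval.
Proof. by move=> s t; apply: val_inj. Qed.

Lemma clampK (r : R) : 0 <= r <= 1 -> uval (clamp r) = r.
Proof.
case/andP=> r0 r1; rewrite /uval set_valE /=.
by rewrite (min_idPr r1) (max_idPr r0).
Qed.

Lemma uvalK : cancel uval clamp.
Proof.
by move=> t; apply: uval_inj; rewrite clampK // uval_ge0 uval_le1.
Qed.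

Lemma unit_interval_zero_one_neq : clamp 0 != clamp 1.
Proof.
apply/eqP => /(congr1 uval); rewrite !clampK ?lexx ?ler01 //.
by move/eqP; rewrite eq_sym oner_eq0.
Qed.

HB.instance Definition _ :=
  isBiPointed.Build I unit_interval_zero_one_neq.

Lemma uval0 : uval zero = 0.
Proof. by rewrite clampK // lexx ler01. Qed.

Lemma uval1 : uval one = 1.
Proof. by rewrite clampK // lexx ler01. Qed.

Lemma clamp0 : clamp 0 = zero. Proof. by []. Qed.

Lemma clamp1 : clamp 1 = one. Proof. by []. Qed.

Lemma continuous_uval : continuous uval.
Proof. exact: initial_continuous. Qed.

Lemma continuous_clamp : continuous clamp.
Proof.
apply: continuous_comp_initial => x.
apply: (@continuous_max R R (cst 0) (Num.min 1)); first exact: cvg_cst.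
by apply: (@continuous_min R R (cst 1) idfun); [exact: cvg_cst|exact: cvg_id].
Qed.

End UnitInterval.

Section ContinuityLemmas.
Context {R : realType} {T X : topologicalType}.

Lemma continuous_if_le (a : T -> R) (c : R) (f g : T -> X) :
  continuous a -> continuous f -> continuous g ->
  (forall x, a x = c -> f x = g x) ->
  continuous (fun x => if a x <= c then f x else g x).
Proof.
move=> ca cf cg fg x U /= nU.
change (\forall y \near x, U (if a y <= c then f y else g y)).
move: nU; case: (ltgtP (a x) c) => [axc|axc|axc] Ux.
- have na : \forall y \near x, a y < c by exact: (cvgr_lt (a x) (ca x)).
  near=> y; rewrite ifT; last by apply: ltW; near: y.
  by near: y; exact: cf.
- have na : \forall y \near x, c < a y by exact: (cvgr_gt (a x) (ca x)).
  near=> y; rewrite ifF; last by apply/negbTE; rewrite -ltNge; near: y.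
  by near: y; exact: cg.
- have Vx : nbhs (g x) U by rewrite -fg.
  near=> y; case: ifP => _; near: y; [exact: cf|exact: cg].
Unshelve. all: by end_near. Qed.

Lemma continuous_comp2 (Y Z : topologicalType) (H : Y * Z -> X)
    (a : T -> Y) (b : T -> Z) :
  continuous H -> continuous a -> continuous b ->
  continuous (fun u => H (a u, b u)).
Proof.
move=> cH ca cb u.
apply: (@continuous_comp _ _ _ (fun u => (a u, b u)) H); last exact: cH.
by apply: cvg_pair; [exact: ca|exact: cb].
Qed.

Lemma continuous_comp1 (Y : topologicalType) (H : Y -> X) (a : T -> Y) :
  continuous H -> continuous a -> continuous (fun u => H (a u)).
Proof.
move=> cH ca u.
by apply: (@continuous_comp _ _ _ a H); [exact: ca|exact: cH].
Qed.

Lemma continuous_fst (Y Z : topologicalType) : continuous (@fst Y Z).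
Proof. by move=> u; exact: cvg_fst. Qed.

Lemma continuous_snd (Y Z : topologicalType) : continuous (@snd Y Z).
Proof. by move=> u; exact: cvg_snd. Qed.

Lemma continuous_addf (a b : T -> R) :
  continuous a -> continuous b -> continuous (fun u => a u + b u).
Proof. by move=> ca cb u; apply: cvgD; [exact: ca|exact: cb]. Qed.

Lemma continuous_oppf (a : T -> R) :
  continuous a -> continuous (fun u => - a u).
Proof. by move=> ca u; apply: cvgN; exact: ca. Qed.

Lemma continuous_mulf (a b : T -> R) :
  continuous a -> continuous b -> continuous (fun u => a u * b u).
Proof. by move=> ca cb u; apply: cvgM; [exact: ca|exact: cb]. Qed.

Lemma continuous_minf (a b : T -> R) :
  continuous a -> continuous b -> continuous (fun u => Num.min (a u) (b u)).
Proof. by move=> ca cb u; apply: continuous_min; [exact: ca|exact: cb]. Qed.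

Lemma continuous_cstf (Y : topologicalType) (y : Y) :
  continuous (fun _ : T => y).
Proof. by move=> u; exact: cvg_cst. Qed.

End ContinuityLemmas.

Ltac solve_continuous :=
  first
  [ assumption
  | lazymatch goal with
    | |- continuous (fun u => u) => by move=> ?; exact: cvg_id
    | |- continuous fst => exact: continuous_fst
    | |- continuous snd => exact: continuous_snd
    | |- continuous uval => exact: continuous_uval
    | |- continuous (fun u => (_ + _)%R) =>
        apply: continuous_addf; solve_continuous
    | |- continuous (fun u => (- _)%R) =>
        apply: continuous_oppf; solve_continuous
    | |- continuous (fun u => (_ * _)%R) =>
        apply: continuous_mulf; solve_continuous
    | |- continuous (fun u => Order.min _ _) =>
        apply: continuous_minf; solve_continuous
    | |- continuous (fun u => clamp _) =>
        apply: (continuous_comp1 (@continuous_clamp _)); solve_continuous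
    | |- continuous (fun u => uval _) =>
        apply: (continuous_comp1 (@continuous_uval _)); solve_continuous
    end
  | exact: continuous_cstf
  | apply: continuous_comp2; solve_continuous
  | exact: cts_fun
  | idtac ].

Section PathHomotopy.
Context {R : realType} {X : topologicalType}.
Local Notation I := (unit_interval R).

Definition path_homotopic (x y : X) (f g : {path I from x to y}) : Prop :=
  exists H : I * I -> X,
    [/\ continuous H,
        forall t, H (t, zero) = f t,
        forall t, H (t, one) = g t,
        forall s, H (zero, s) = x &
        forall s, H (one, s) = y].

Lemma path_homotopic_reparam (x y : X) (f : I -> X) (phi psi : I -> I)
    (g h : {path I from x to y}) :
  continuous f -> continuous phi -> continuous psi ->
  phi zero = psi zero -> phi one = psi one ->
  (forall t, g t = f (phi t)) -> (forall t, h t = f (psi t)) ->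
  path_homotopic g h.
Proof.
move=> cf cphi cpsi e0 e1 gE hE.
exists (fun u => f (clamp ((1 - uval u.2) * uval (phi u.1)
                           + uval u.2 * uval (psi u.1)))); split => /=.
- have c1 : continuous (fun u : I * I => phi u.1).
    exact: (continuous_comp1 cphi (@continuous_fst _ _)).
  have c2 : continuous (fun u : I * I => psi u.1).
    exact: (continuous_comp1 cpsi (@continuous_fst _ _)).
  by apply: (continuous_comp1 cf); solve_continuous.
- by move=> t; rewrite uval0 subr0 mul1r mul0r addr0 uvalK gE.
- by move=> t; rewrite uval1 subrr mul0r add0r mul1r uvalK hE.
- move=> s; rewrite e0 -mulrDl subrK mul1r uvalK -hE; exact: path_zero.
- move=> s; rewrite e1 -mulrDl subrK mul1r uvalK -hE; exact: path_one.
Qed.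

Lemma path_homotopic_eq (x y : X) (f g : {path I from x to y}) :
  f =1 g -> path_homotopic f g.
Proof.
move=> fg; exists (fun u => f u.1); split => //=.
- by apply: continuous_comp1; solve_continuous.
- by move=> s; exact: path_zero.
- by move=> s; exact: path_one.
Qed.

Lemma path_homotopic_refl (x y : X) (f : {path I from x to y}) :
  path_homotopic f f.
Proof. exact: path_homotopic_eq. Qed.

Lemma path_homotopic_sym (x y : X) (f g : {path I from x to y}) :
  path_homotopic f g -> path_homotopic g f.
Proof.
case=> H [cH H0 H1 Hx Hy].
exists (fun u => H (u.1, clamp (1 - uval u.2))); split => //=.
- by apply: continuous_comp2 => //; solve_continuous.
- by move=> t; rewrite uval0 subr0 clamp1 H1.
- by move=> t; rewrite uval1 subrr clamp0 H0.
Qed.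

Lemma path_homotopic_trans (x y : X) (f g h : {path I from x to y}) :
  path_homotopic f g -> path_homotopic g h -> path_homotopic f h.
Proof.
case=> H [cH H0 H1 Hx Hy] [K [cK K0 K1 Kx Ky]].
exists (fun u => if uval u.2 <= 1 / 2 then H (u.1, clamp (2 * uval u.2))
                 else K (u.1, clamp (2 * uval u.2 - 1))); split => /=.
- apply: continuous_if_le.
  + by solve_continuous.
  + by apply: continuous_comp2 => //; solve_continuous.
  + by apply: continuous_comp2 => //; solve_continuous.
  + move=> u ->; rewrite (_ : 2 * (1 / 2) = 1 :> R); last lra.
    by rewrite subrr clamp0 clamp1 H1 K0.
- by move=> t; rewrite uval0 ifT ?mulr0 ?clamp0 ?H0 //; lra.
- move=> t; rewrite uval1 ifF; last by apply/negbTE; rewrite -ltNge; lra.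
  by rewrite (_ : 2 * 1 - 1 = 1 :> R) ?clamp1 ?K1 //; lra.
- by move=> s; case: ifP => _; rewrite ?Hx ?Kx.
- by move=> s; case: ifP => _; rewrite ?Hy ?Ky.
Qed.

(* The library's chain_path lives on the wedge of two intervals; this is the
   concatenation reparametrized over the interval itself. *)
Definition path_concat_fun (f g : I -> X) (t : I) : X :=
  if uval t <= 1 / 2 then f (clamp (2 * uval t))
  else g (clamp (2 * uval t - 1)).

Section Concat.
Context (x y z : X) (f : {path I from x to y}) (g : {path I from y to z}).

Lemma path_concat_continuous : continuous (path_concat_fun f g).
Proof.
apply: continuous_if_le; first exact: continuous_uval.
- by apply: continuous_comp1; solve_continuous.
- by apply: continuous_comp1; solve_continuous.
- move=> t ->; rewrite (_ : 2 * (1 / 2) = 1 :> R); last lra.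
  by rewrite subrr clamp0 clamp1 path_zero path_one.
Qed.

Lemma path_concat_zero : path_concat_fun f g zero = x.
Proof.
rewrite /path_concat_fun uval0 mulr0 clamp0 ifT ?path_zero //; lra.
Qed.

Lemma path_concat_one : path_concat_fun f g one = z.
Proof.
rewrite /path_concat_fun uval1 ifF; last by apply/negbTE; rewrite -ltNge; lra.
by rewrite (_ : 2 * 1 - 1 = 1 :> R) ?clamp1 ?path_one //; lra.
Qed.

Definition path_concat : {path I from x to z} :=
  mk_path path_concat_continuous path_concat_zero path_concat_one.

Lemma path_concat_clamp (r : R) : 0 <= r <= 1 ->
  path_concat (clamp r) =
  if r <= 1 / 2 then f (clamp (2 * r)) else g (clamp (2 * r - 1)).
Proof.
by move=> r01; rewrite /path_concat /= /mk_path /path_concat_fun clampK.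
Qed.

End Concat.

Section Reverse.
Context (x y : X) (f : {path I from x to y}).

Definition path_reverse_fun (t : I) : X := f (clamp (1 - uval t)).

Lemma path_reverse_continuous : continuous path_reverse_fun.
Proof. by apply: continuous_comp1; solve_continuous. Qed.

Lemma path_reverse_zero : path_reverse_fun zero = y.
Proof. by rewrite /path_reverse_fun uval0 subr0 clamp1 path_one. Qed.

Lemma path_reverse_one : path_reverse_fun one = x.
Proof. by rewrite /path_reverse_fun uval1 subrr clamp0 path_zero. Qed.

Definition path_reverse : {path I from y to x} :=
  mk_path path_reverse_continuous path_reverse_zero path_reverse_one.

Lemma path_reverse_clamp (r : R) : 0 <= r <= 1 ->
  path_reverse (clamp r) = f (clamp (1 - r)).
Proof.
by move=> r01; rewrite /path_reverse /= /mk_path /path_reverse_fun clampK.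
Qed.

End Reverse.

Lemma path_concat_homotopic (x y z : X) (f f' : {path I from x to y})
    (g g' : {path I from y to z}) :
  path_homotopic f f' -> path_homotopic g g' ->
  path_homotopic (path_concat f g) (path_concat f' g').
Proof.
case=> H [cH H0 H1 Hx Hy] [K [cK K0 K1 Kx Ky]].
exists (fun u => if uval u.1 <= 1 / 2 then H (clamp (2 * uval u.1), u.2)
                 else K (clamp (2 * uval u.1 - 1), u.2)); split => /=.
- apply: continuous_if_le.
  + by solve_continuous.
  + by apply: continuous_comp2 => //; solve_continuous.
  + by apply: continuous_comp2 => //; solve_continuous.
  + move=> u ->; rewrite (_ : 2 * (1 / 2) = 1 :> R); last lra.
    by rewrite subrr clamp0 clamp1 Hy Kx.
- by move=> t; rewrite H0 K0.
- by move=> t; rewrite H1 K1.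
- by move=> s; rewrite uval0 mulr0 clamp0 ifT ?Hx //; lra.
- move=> s; rewrite uval1 ifF; last by apply/negbTE; rewrite -ltNge; lra.
  by rewrite (_ : 2 * 1 - 1 = 1 :> R) ?clamp1 ?Ky //; lra.
Qed.

Lemma path_reverse_homotopic (x y : X) (f f' : {path I from x to y}) :
  path_homotopic f f' -> path_homotopic (path_reverse f) (path_reverse f').
Proof.
case=> H [cH H0 H1 Hx Hy].
exists (fun u => H (clamp (1 - uval u.1), u.2)); split => /=.
- by apply: continuous_comp2 => //; solve_continuous.
- by move=> t; rewrite H0.
- by move=> t; rewrite H1.
- by move=> s; rewrite uval0 subr0 clamp1 Hy.
- by move=> s; rewrite uval1 subrr clamp0 Hx.
Qed.

Lemma uval_clampP (t : I) : exists2 r : R, 0 <= r <= 1 & t = clamp r.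
Proof. by exists (uval t); rewrite ?uval_ge0 ?uval_le1 ?uvalK. Qed.

Lemma path_concatA (w x y z : X) (f : {path I from w to x})
    (g : {path I from x to y}) (h : {path I from y to z}) :
  path_homotopic (path_concat f (path_concat g h))
                 (path_concat (path_concat f g) h).
Proof.
pose phi (t : I) : I := clamp (Num.min (2 * uval t)
  (Num.min (uval t + 1 / 4) ((uval t + 1) / 2))).
apply: (@path_homotopic_reparam _ _
  (path_concat f (path_concat g h)) idfun phi).
- exact: cts_fun.
- by move=> t; exact: cvg_id.
- by rewrite /phi; solve_continuous.
- rewrite /phi /= uval0 -clamp0; congr clamp.
  by case: (leP (0 + 1 / 4)) => ?; case: leP => ?; lra.
- rewrite /phi /= uval1 -clamp1; congr clamp.
  by case: (leP (1 + 1 / 4)) => ?; case: leP => ?; lra.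
- by [].
- move=> t; rewrite /phi; have [r /andP[r0 r1] ->] := uval_clampP t.
  rewrite clampK ?r0 //.
  have [r14|r14] := leP r (1 / 4).
    rewrite (_ : Num.min (2 * r) _ = 2 * r); last first.
      by case: (leP (r + 1 / 4)) => ?; case: leP => ?; lra.
    rewrite path_concat_clamp ?r0 // ifT; last lra.
    rewrite path_concat_clamp; last lra.
    rewrite ifT; last lra.
    rewrite path_concat_clamp; last lra.
    by rewrite ifT; last lra.
  have [r12|r12] := leP r (1 / 2).
    rewrite (_ : Num.min (2 * r) _ = r + 1 / 4); last first.
      by case: (leP (r + 1 / 4)) => ?; case: leP => ?; lra.
    rewrite path_concat_clamp ?r0 // r12 path_concat_clamp; last lra.
    rewrite ifF; last by apply/negbTE; rewrite -ltNge; lra.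
    rewrite path_concat_clamp; last lra.
    rewrite ifF; last by apply/negbTE; rewrite -ltNge; lra.
    rewrite path_concat_clamp; last lra.
    by rewrite ifT; [congr (g (clamp _)); lra | lra].
  rewrite (_ : Num.min (2 * r) _ = (r + 1) / 2); last first.
    by case: (leP (r + 1 / 4)) => ?; case: leP => ?; lra.
  rewrite path_concat_clamp ?r0 //.
  rewrite ifF; last by apply/negbTE; rewrite -ltNge; lra.
  rewrite path_concat_clamp; last lra.
  rewrite ifF; last by apply/negbTE; rewrite -ltNge; lra.
  rewrite path_concat_clamp; last lra.
  rewrite ifF; last by apply/negbTE; rewrite -ltNge; lra.
  by congr (h (clamp _)); lra.
Qed.

Lemma path_concat1p (x y : X) (f : {path I from x to y}) :
  path_homotopic (path_concat (cst x) f) f.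
Proof.
pose phi (t : I) : I := clamp (- Num.min 0 (1 - 2 * uval t)).
apply: (@path_homotopic_reparam _ _ f phi idfun).
- exact: cts_fun.
- by rewrite /phi; solve_continuous.
- by move=> t; exact: cvg_id.
- by rewrite /phi /= uval0 -clamp0; congr clamp; case: leP => ?; lra.
- by rewrite /phi /= uval1 -clamp1; congr clamp; case: leP => ?; lra.
- move=> t; rewrite /phi; have [r /andP[r0 r1] ->] := uval_clampP t.
  rewrite path_concat_clamp ?clampK ?r0 //.
  have [r12|r12] := leP r (1 / 2).
    rewrite (_ : - _ = 0); last by case: leP => ?; lra.
    by rewrite clamp0 path_zero.
  by congr (f (clamp _)); case: leP => ?; lra.
- by [].
Qed.

Lemma path_concatp1 (x y : X) (f : {path I from x to y}) :
  path_homotopic (path_concat f (cst y)) f.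
Proof.
pose phi (t : I) : I := clamp (Num.min 1 (2 * uval t)).
apply: (@path_homotopic_reparam _ _ f phi idfun).
- exact: cts_fun.
- by rewrite /phi; solve_continuous.
- by move=> t; exact: cvg_id.
- by rewrite /phi /= uval0 -clamp0; congr clamp; case: leP => ?; lra.
- by rewrite /phi /= uval1 -clamp1; congr clamp; case: leP => ?; lra.
- move=> t; rewrite /phi; have [r /andP[r0 r1] ->] := uval_clampP t.
  rewrite path_concat_clamp ?clampK ?r0 //.
  have [r12|r12] := leP r (1 / 2).
    by congr (f (clamp _)); case: leP => ?; lra.
  rewrite (_ : Num.min _ _ = 1); last by case: leP => ?; lra.
  by rewrite clamp1 path_one.
- by [].
Qed.

Lemma path_concatpV (x y : X) (f : {path I from x to y}) :
  path_homotopic (path_concat f (path_reverse f)) (cst x).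
Proof.
pose phi (t : I) : I := clamp (Num.min (2 * uval t) (2 - 2 * uval t)).
apply: (@path_homotopic_reparam _ _ f phi (fun=> zero)).
- exact: cts_fun.
- by rewrite /phi; solve_continuous.
- by solve_continuous.
- by rewrite /phi /= uval0 -clamp0; congr clamp; case: leP => ?; lra.
- by rewrite /phi /= uval1 -clamp0; congr clamp; case: leP => ?; lra.
- move=> t; rewrite /phi; have [r /andP[r0 r1] ->] := uval_clampP t.
  rewrite path_concat_clamp ?clampK ?r0 //.
  have [r12|r12] := leP r (1 / 2).
    by congr (f (clamp _)); case: leP => ?; lra.
  rewrite path_reverse_clamp; last lra.
  by congr (f (clamp _)); case: leP => ?; lra.
- by move=> t; rewrite path_zero.
Qed.

Lemma path_concatVp (x y : X) (f : {path I from x to y}) :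
  path_homotopic (path_concat (path_reverse f) f) (cst y).
Proof.
pose phi (t : I) : I := clamp (- Num.min (2 * uval t - 1) (1 - 2 * uval t)).
apply: (@path_homotopic_reparam _ _ f phi (fun=> one)).
- exact: cts_fun.
- by rewrite /phi; solve_continuous.
- by solve_continuous.
- by rewrite /phi /= uval0 -clamp1; congr clamp; case: leP => ?; lra.
- by rewrite /phi /= uval1 -clamp1; congr clamp; case: leP => ?; lra.
- move=> t; rewrite /phi; have [r /andP[r0 r1] ->] := uval_clampP t.
  rewrite path_concat_clamp ?clampK ?r0 //.
  have [r12|r12] := leP r (1 / 2).
    rewrite path_reverse_clamp; last lra.
    by congr (f (clamp _)); case: leP => ?; lra.
  by congr (f (clamp _)); case: leP => ?; lra.
- by move=> t; rewrite path_one.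
Qed.

End PathHomotopy.

Section FundamentalGroup.
Context (R : realType) {X : topologicalType} (x0 : X).
Local Notation I := (unit_interval R).
Local Notation loop := {path I from x0 to x0}.

Definition loop_equiv (f g : loop) : bool := `[< path_homotopic f g >].

Lemma loop_equiv_refl : reflexive loop_equiv.
Proof. by move=> f; apply/asboolP; exact: path_homotopic_refl. Qed.

Lemma loop_equiv_sym : symmetric loop_equiv.
Proof.
by move=> f g; apply/asboolP/asboolP; exact: path_homotopic_sym.
Qed.

Lemma loop_equiv_trans : transitive loop_equiv.
Proof.
move=> g f h /asboolP fg /asboolP gh; apply/asboolP.
exact: path_homotopic_trans gh.
Qed.

Canonical loop_equiv_rel :=
  EquivRel loop_equiv loop_equiv_refl loop_equiv_sym loop_equiv_trans.

Definition fundamental_group : Type := {eq_quot loop_equiv_rel}.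

HB.instance Definition _ := Choice.on fundamental_group.

Definition loop_class (f : loop) : fundamental_group :=
  \pi_{eq_quot loop_equiv_rel} f.

Definition loop_repr (u : fundamental_group) : loop :=
  repr (u : {eq_quot loop_equiv_rel}).

Lemma loop_reprK : cancel loop_repr loop_class.
Proof. by move=> u; rewrite /loop_class /loop_repr reprK. Qed.

Lemma loop_classP (f g : loop) :
  loop_class f = loop_class g <-> path_homotopic f g.
Proof.
by rewrite /loop_class; split => [/eqmodP/asboolP //|fg]; apply/eqmodP/asboolP.
Qed.

Lemma loop_repr_homotopic (f : loop) :
  path_homotopic (loop_repr (loop_class f)) f.
Proof. by apply/loop_classP; rewrite loop_reprK. Qed.

Definition fg_mul (u v : fundamental_group) : fundamental_group :=
  loop_class (path_concat (loop_repr u) (loop_repr v)).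

Definition fg_one : fundamental_group := loop_class (cst x0).

Definition fg_inv (u : fundamental_group) : fundamental_group :=
  loop_class (path_reverse (loop_repr u)).

Lemma fg_mulE (f g : loop) :
  fg_mul (loop_class f) (loop_class g) = loop_class (path_concat f g).
Proof.
apply/loop_classP; apply: path_concat_homotopic; exact: loop_repr_homotopic.
Qed.

Lemma fg_invE (f : loop) :
  fg_inv (loop_class f) = loop_class (path_reverse f).
Proof.
apply/loop_classP; apply: path_reverse_homotopic; exact: loop_repr_homotopic.
Qed.

Lemma fg_mulA : associative fg_mul.
Proof.
move=> u v w; rewrite -(loop_reprK u) -(loop_reprK v) -(loop_reprK w) !fg_mulE.
by apply/loop_classP; exact: path_concatA.
Qed.

Lemma fg_mul1g : left_id fg_one fg_mul.
Proof.
move=> u; rewrite -(loop_reprK u) fg_mulE.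
by apply/loop_classP; exact: path_concat1p.
Qed.

Lemma fg_mulg1 : right_id fg_one fg_mul.
Proof.
move=> u; rewrite -(loop_reprK u) fg_mulE.
by apply/loop_classP; exact: path_concatp1.
Qed.

Lemma fg_mulVg : left_inverse fg_one fg_inv fg_mul.
Proof.
move=> u; rewrite -(loop_reprK u) fg_invE fg_mulE.
by apply/loop_classP; exact: path_concatVp.
Qed.

Lemma fg_mulgV : right_inverse fg_one fg_inv fg_mul.
Proof.
move=> u; rewrite -(loop_reprK u) fg_invE fg_mulE.
by apply/loop_classP; exact: path_concatpV.
Qed.

HB.instance Definition _ := isGroup.Build fundamental_group
  fg_mulA fg_mul1g fg_mulg1 fg_mulVg fg_mulgV.

End FundamentalGroup.

Section InducedMap.
(* The target base point is kept separate from f x0, so that two maps agreeing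
   at x0 induce homomorphisms into the same group. *)
Context (R : realType) {X Y : topologicalType} (f : continuousType X Y).
Context (x0 : X) (y0 : Y) (fx0 : f x0 = y0).
Local Notation I := (unit_interval R).

Section MapLoop.
Context (a : {path I from x0 to x0}).

Lemma map_loop_continuous : continuous (f \o a).
Proof. exact: cts_fun. Qed.

Lemma map_loop_zero : (f \o a) zero = y0.
Proof. by rewrite /= path_zero. Qed.

Lemma map_loop_one : (f \o a) one = y0.
Proof. by rewrite /= path_one. Qed.

Definition map_loop : {path I from y0 to y0} :=
  mk_path map_loop_continuous map_loop_zero map_loop_one.

End MapLoop.

Lemma map_loop_homotopic (a b : {path I from x0 to x0}) :
  path_homotopic a b -> path_homotopic (map_loop a) (map_loop b).
Proof.
case=> H [cH H0 H1 Hx Hy]; exists (f \o H); split => /=.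
- by apply: continuous_comp1 => //; exact: cts_fun.
- by move=> t; rewrite H0.
- by move=> t; rewrite H1.
- by move=> s; rewrite Hx.
- by move=> s; rewrite Hy.
Qed.

Definition pi1_map (u : fundamental_group R x0) : fundamental_group R y0 :=
  loop_class (map_loop (loop_repr u)).

Lemma pi1_mapE (a : {path I from x0 to x0}) :
  pi1_map (loop_class a) = loop_class (map_loop a).
Proof.
by apply/loop_classP; apply: map_loop_homotopic; exact: loop_repr_homotopic.
Qed.

Lemma pi1_map_monoid_morphism : monoid.monoid_morphism pi1_map.
Proof.
split.
  rewrite [LHS]pi1_mapE; apply/loop_classP/path_homotopic_eq => t.
  by rewrite /= /mk_path /= fx0.
move=> u v; rewrite -(loop_reprK u) -(loop_reprK v).
rewrite [X in pi1_map X]fg_mulE !pi1_mapE [RHS]fg_mulE.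
apply/loop_classP/path_homotopic_eq => t.
by rewrite /= /mk_path /= /path_concat_fun /=; case: ifP.
Qed.

HB.instance Definition _ :=
  isUMagmaMorphism.Build _ _ pi1_map pi1_map_monoid_morphism.

End InducedMap.

Arguments pi1_map R {X Y f x0 y0} fx0 u.

Definition path_connected (R : realType) (X : topologicalType) : Prop :=
  [set: X] !=set0 /\
  forall x y : X, inhabited {path (unit_interval R) from x to y}.

Definition homeomorphism (X Y : topologicalType) (h : X -> Y) : Prop :=
  continuous h /\
  exists k : Y -> X, [/\ continuous k, cancel h k & cancel k h].

(* f restricts to a homeomorphism from the subspace A onto the subspace B. *)
Definition homeomorphism_on (X Y : topologicalType) (A : set X) (B : set Y)
    (f : X -> Y) : Prop :=
  exists k : Y -> X,
    [/\ {within A, continuous f}, {within B, continuous k},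
        set_fun A B f, set_fun B A k &
        {in A, cancel f k} /\ {in B, cancel k f}].

Definition evenly_covered (E B : topologicalType) (p : E -> B) (U : set B)
    : Prop :=
  exists S : set (set E),
    [/\ forall V, S V -> open V,
        trivIset S id,
        p @^-1` U = \bigcup_(V in S) V &
        forall V, S V -> homeomorphism_on V U p].

Definition covering_map (E B : topologicalType) (p : E -> B) : Prop :=
  [/\ continuous p, set_surj setT setT p &
      forall b, exists U, [/\ open U, U b & evenly_covered p U]].

Definition two_fold_covering (E B : topologicalType) (p : E -> B) : Prop :=
  covering_map p /\ forall b, (p @^-1` [set b] #= `I_2)%card.

Definition equivalent_coverings (E B : topologicalType) (p q : E -> B) : Prop :=
  exists h : E -> E, homeomorphism h /\ q \o h = p.

(* Main.v *)
(* E is the punctured plane with its topology coarsened so that the points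
   (0, n) converge to (1, 0) and the points (0, -n) converge to (-1, 0).  This
   adds no path: close to a pinch point, the pieces around the points of the
   attached sequence are clopen, so a path starting at the pinch point cannot
   jump into one of them.
   The antipode z |-> -z respects the coarsening; let p : E -> B be the
   quotient by it.  The reflection c : (x, y) |-> (x, -y) fixes (1, 0) but
   exchanges the two sequences, so it is not continuous on E.  It does send
   paths to paths, and it permutes the antipode-invariant open sets, so
   q = p o c is again a two-fold covering, with the same image on pi_1.
   An equivalence between p and q would be z |-> c z or z |-> - c z at each
   point, with a constant sign by path-connectedness, and neither is
   continuous. *)
Require Import Defs.
From HB Require Import structures.
From mathcomp Require Import all_boot all_order all_algebra generic_quotient.
From mathcomp Require Import lra.
From mathcomp Require Import all_classical reals topology normedtype homotopy.

Set Implicit Arguments.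
Unset Strict Implicit.
Unset Printing Implicit Defensive.

Import Order.TTheory GRing.Theory Num.Theory.
Import numFieldNormedType.Exports.

Local Open Scope classical_set_scope.
Local Open Scope ring_scope.

(** * Two-fold coverings from free involutions *)

Section InvolutionQuotient.
Context {E B : topologicalType} (s : E -> E) (f : E -> B).
Hypotheses (s_continuous : continuous s) (sK : involutive s).
Hypothesis s_disjoint :
  forall z, exists V : set E, [/\ open V, V z & forall w, V w -> ~ V (s w)].
Hypothesis f_eqP : forall z w, f z = f w <-> z = w \/ z = s w.
Hypothesis f_surj : forall b, exists z, f z = b.
Hypothesis f_openP : forall U : set B, open U <-> open (f @^-1` U).

Lemma quotient_map_sym z : f (s z) = f z.
Proof. by apply/f_eqP; right. Qed.

Lemma quotient_image_preimage (V : set E) : f @^-1` (f @` V) = V `|` s @^-1` V.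
Proof.
apply/seteqP; split=> z /=.
  by case=> w Vw /f_eqP[<-|wz]; [left|right; rewrite -wz].
by case=> Vz; [exists z|exists (s z); rewrite ?quotient_map_sym].
Qed.

Lemma quotient_map_open (V : set E) : open V -> open (f @` V).
Proof.
move=> oV; apply/f_openP; rewrite quotient_image_preimage; apply: openU => //.
by move/continuousP: s_continuous; apply.
Qed.

(** Since [V] misses its image under [s], each fiber meets [V] in at most one point, so [f] is
    injective on [V]. The inverse is continuous because [f] is an open map. *)
Lemma quotient_sheet_homeomorphism (V : set E) :
  open V -> (forall w, V w -> ~ V (s w)) -> homeomorphism_on V (f @` V) f.
Proof.
move=> oV Vs; have [r rK] := choice f_surj.
have [k kK] : exists k, forall z, V z -> k (f z) = z.
  (* An arbitrary section [r] is corrected by [s] wherever it picks the point of the fiber outside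
     [V]. *)
  exists (fun b => if `[< V (r b) >] then r b else s (r b)) => z Vz.
  have /f_eqP[rz|rz] := rK (f z).
    by rewrite rz asboolT.
  by rewrite rz asboolF ?sK //; exact: Vs.
exists k; split.
- apply: continuous_subspaceT; apply/continuousP => U oU; exact/f_openP.
- apply/continuousP => U oU; apply/open_subspaceP.
  exists (f @` (V `&` U)); first by apply: quotient_map_open; exact: openI.
  apply/seteqP; split=> b.
    case=> -[z [Vz Uz] <-] _; split; last by exists z.
    by change (U (k (f z))); rewrite kK.
  case=> Ukb [z Vz zb]; have {Ukb} : U (k b) by [].
  by rewrite -zb kK // => Uz; split; exists z.
- by move=> z Vz; exists z.
- by move=> _ [z Vz <-]; rewrite kK.
- by split=> [z /set_mem /kK//|b /set_mem[z Vz <-]]; rewrite kK.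
Qed.

(** The sheets over [f @] V[are]V[and]s @^-1[V]. Only the fibers of [f] and the quotient topology on
    [B] enter, not a particular construction of [B], so the lemma serves both [antipodal_proj] and
    [mirror_proj]. *)
Lemma involution_quotient_two_fold : two_fold_covering f.
Proof.
split.
  split; first by apply/continuousP => U /f_openP.
    by move=> b _; have [z <-] := f_surj b; exists z.
  move=> b; have [z <-] := f_surj b; have [V [oV Vz Vs]] := s_disjoint z.
  have osV : open (s @^-1` V) by move/continuousP: s_continuous; apply.
  have sVs w : (s @^-1` V) w -> ~ (s @^-1` V) (s w).
    by rewrite /= sK => /[swap]; exact: Vs.
  have fsV : f @` (s @^-1` V) = f @` V.
    apply/seteqP; split=> _ [w Vw <-].
      by exists (s w); rewrite ?quotient_map_sym.
    by exists (s w); rewrite ?quotient_map_sym //= sK.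
  exists (f @` V); split; [exact: quotient_map_open|by exists z|].
  exists [set V; s @^-1` V]; split.
  - by move=> _ [] ->.
  - move=> _ _ [->|->] [->|->] // [w [/=]].
      by move=> /Vs.
    by move=> /[swap] /Vs.
  - by rewrite quotient_image_preimage bigcup_setU !bigcup_set1.
  - move=> _ [] ->; first exact: quotient_sheet_homeomorphism.
    by rewrite -fsV; exact: quotient_sheet_homeomorphism.
move=> b; have [z <-] := f_surj b.
have sz : s z <> z.
  by move=> e; have [V [_ Vz /(_ _ Vz)]] := s_disjoint z; rewrite e.
apply/card_set_bijP; exists (fun w => if `[< w = z >] then 0%N else 1%N); split.
- by move=> w _ /=; case: asboolP.
- move=> v w /set_mem /= /f_eqP v_ /set_mem /= /f_eqP w_.
  case: asboolP => [->|vz]; case: asboolP => [->|wz] // _.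
  by case: v_ => // ->; case: w_ => // ->.
- move=> [|[|//]] _ /=.
    by exists z => //; rewrite asboolT.
  by exists (s z); rewrite /= ?quotient_map_sym // asboolF.
Qed.

End InvolutionQuotient.

(** * Joining points by paths *)

Section PathJoined.
Context {R : realType} {X : topologicalType}.
Local Notation I := (unit_interval R).

Definition path_joined (x y : X) : Prop := inhabited {path I from x to y}.

Lemma path_joined_sym x y : path_joined x y -> path_joined y x.
Proof. by case=> g; constructor; exact: path_reverse g. Qed.

Lemma path_joined_trans y x z :
  path_joined x y -> path_joined y z -> path_joined x z.
Proof. by case=> f [g]; constructor; exact: path_concat f g. Qed.

End PathJoined.

Lemma path_connected_image (R : realType) (X Y : topologicalType)
    (f : continuousType X Y) :
  (forall y, exists x, f x = y) -> path_connected R X -> path_connected R Y.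
Proof.
move=> fs [[x _] cX]; split; first by exists (f x).
move=> u v; have [a <-] := fs u; have [b <-] := fs v.
by have [g] := cX a b; constructor; exact: (f \o g : {path _ from f a to f b}).
Qed.

(** * The punctured plane and its coordinates *)

Definition punctured_plane (R : realType) : Type :=
  set_type [set z : R * R | z != 0].

HB.instance Definition _ (R : realType) :=
  Topological.copy (punctured_plane R) (set_type [set z : R * R | z != 0]).

(** An alias that can carry a second topology on the same points: sets and maps of the punctured
    plane are read in it by conversion. *)
Definition pinched_plane (R : realType) : Type := punctured_plane R.

HB.instance Definition _ (R : realType) :=
  Choice.copy (pinched_plane R) (punctured_plane R).

Section PinchedPlane.
Context {R : realType}.
Local Notation F := (punctured_plane R).
Local Notation E := (pinched_plane R).

Definition xcoord (z : F) : R := (set_val z).1.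
Definition ycoord (z : F) : R := (set_val z).2.

Lemma coord_neq0 (z : F) : xcoord z != 0 \/ ycoord z != 0.
Proof.
case: z => -[x y] /= nz; have := set_mem nz.
rewrite /xcoord /ycoord !set_valE /=.
by have [->|] := eqVneq x 0; [right; apply: contra H => /eqP->|left].
Qed.

Lemma coord_inj (z w : F) :
  xcoord z = xcoord w -> ycoord z = ycoord w -> z = w.
Proof.
move=> e1 e2; apply: val_inj; move: e1 e2; rewrite /xcoord /ycoord !set_valE.
by case: (val z) (val w) => [? ?] [? ?] /= -> ->.
Qed.

Lemma mk_point_subproof (x y : R) :
  (if (x, y) == 0 then (1, 0) else (x, y)) \in [set z : R * R | z != 0].
Proof.
rewrite inE /=; case: ifPn => // _.
by apply/eqP => -[/eqP]; rewrite oner_eq0.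
Qed.

(** Made total by sending the origin to the default point (1, 0); the coordinates are the given ones
    only away from the origin, as in [mk_pointE]. *)
Definition mk_point (x y : R) : F :=
  exist (fun z => z \in [set z : R * R | z != 0]) _ (mk_point_subproof x y).

Lemma mk_pointE (x y : R) : x != 0 \/ y != 0 ->
  xcoord (mk_point x y) = x /\ ycoord (mk_point x y) = y.
Proof.
move=> h; rewrite /xcoord /ycoord /mk_point !set_valE /=.
by case: ifP => // /eqP[x0 y0]; move: h; rewrite x0 y0 eqxx => -[].
Qed.

Lemma xcoordE (x y : R) : x != 0 \/ y != 0 -> xcoord (mk_point x y) = x.
Proof. by case/mk_pointE. Qed.

Lemma ycoordE (x y : R) : x != 0 \/ y != 0 -> ycoord (mk_point x y) = y.
Proof. by case/mk_pointE. Qed.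

Lemma continuous_xcoord : continuous xcoord.
Proof.
apply: (continuous_comp1 (@continuous_fst _ _)).
exact: initial_continuous.
Qed.

Lemma continuous_ycoord : continuous ycoord.
Proof.
apply: (continuous_comp1 (@continuous_snd _ _)).
exact: initial_continuous.
Qed.

Lemma continuous_punctured (T : topologicalType) (f : T -> F) :
  continuous (xcoord \o f) -> continuous (ycoord \o f) -> continuous f.
Proof.
move=> cx cy; apply: continuous_comp_initial.
have -> : set_val \o f = fun t => (xcoord (f t), ycoord (f t)).
  by apply/funext => u /=; rewrite /xcoord /ycoord; case: (set_val _).
by move=> t; exact: (cvg_pair (cx t) (cy t)).
Qed.

Lemma open_coord (f : F -> R) : continuous f -> open [set z | 0 < f z].
Proof. by move=> /continuousP/(_ _ (@open_gt R 0)). Qed.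

(** * The pinched topology *)

Definition pinch_sign (b : bool) : R := if b then -1 else 1.
Local Notation sgb := pinch_sign.

Lemma pinch_sign_neq0 b : sgb b != 0.
Proof. by case: b; rewrite /pinch_sign ?oppr_eq0 oner_eq0. Qed.

(** [pinch false] is (1, 0), the limit of the upper tail, and [pinch true] is (-1, 0), the limit of
    the lower one. Both tails start at distance one from the origin. *)
Definition pinch b : F := mk_point (sgb b) 0.
Definition tail b n : F := mk_point 0 (sgb b * n.+1%:R).

Lemma xpinch b : xcoord (pinch b) = sgb b.
Proof. by rewrite xcoordE //; left; exact: pinch_sign_neq0. Qed.

Lemma ypinch b : ycoord (pinch b) = 0.
Proof. by rewrite ycoordE //; left; exact: pinch_sign_neq0. Qed.

Lemma tail_neq0 b n : (0 : R) != 0 \/ sgb b * n.+1%:R != 0.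
Proof. by right; rewrite mulf_neq0 ?pinch_sign_neq0 // pnatr_eq0. Qed.

Lemma xtail b n : xcoord (tail b n) = 0.
Proof. by rewrite xcoordE //; exact: tail_neq0. Qed.

Lemma ytail b n : ycoord (tail b n) = sgb b * n.+1%:R.
Proof. by rewrite ycoordE //; exact: tail_neq0. Qed.

Definition pinched_open (U : set E) : Prop :=
  open (U : set F) /\
  forall b, U (pinch b) -> exists N, forall n, (N <= n)%N -> U (tail b n).

Lemma pinched_openT : pinched_open setT.
Proof. by split; [exact: openT|exists 0%N]. Qed.

Lemma pinched_openI : setI_closed pinched_open.
Proof.
move=> U V [oU tU] [oV tV]; split; first exact: openI.
move=> b [/tU[N HN] /tV[M HM]]; exists (maxn N M) => n.
by rewrite geq_max => /andP[/HN ? /HM].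
Qed.

Lemma pinched_open_bigU (I : Type) (f : I -> set E) :
  (forall i, pinched_open (f i)) -> pinched_open (\bigcup_i f i).
Proof.
move=> fo; split; first by apply: bigcup_open => i _; case: (fo i).
by move=> b [i _ /(fo i).2[N HN]]; exists N => n Nn; exists i => //; exact: HN.
Qed.

HB.instance Definition _ := isOpenTopological.Build E
  pinched_openT pinched_openI pinched_open_bigU.

(** The pinched topology is coarser than that of the punctured plane. *)
Lemma continuous_pinched (T : topologicalType) (f : T -> E) :
  continuous (f : T -> F) -> continuous f.
Proof. by move=> /continuousP cf; apply/continuousP => U [/cf]. Qed.

Lemma pinch_coordP (z : F) b :
  0 < (xcoord z - sgb b) ^+ 2 + ycoord z ^+ 2 <-> z <> pinch b.
Proof.
split=> [h zE|zb].
  by move: h; rewrite zE xpinch ypinch subrr !expr0n addr0 ltxx.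
have := addr_ge0 (sqr_ge0 (xcoord z - sgb b)) (sqr_ge0 (ycoord z)).
rewrite le_eqVlt => /orP[|//].
rewrite eq_sym paddr_eq0 ?sqr_ge0 // !sqrf_eq0 subr_eq0.
case/andP=> /eqP ex /eqP ey.
by case: zb; apply: coord_inj; rewrite ?xpinch ?ypinch.
Qed.

Lemma open_setC_pinch b : open (~` [set pinch b] : set F).
Proof.
rewrite (_ : ~` _ =
  [set z | 0 < (xcoord z - sgb b) ^+ 2 + ycoord z ^+ 2]); last first.
  by apply/seteqP; split=> z /= /pinch_coordP.
apply: open_coord; rewrite /GRing.exp /=.
have := continuous_xcoord; have := continuous_ycoord => ? ?.
by solve_continuous.
Qed.

(** Once both pinch points are removed the tail condition is vacuous, so away from them the two
    topologies agree. *)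
Lemma open_without_pinch (U : set F) :
  open U -> open (U `&` ~` [set pinch true] `&` ~` [set pinch false] : set E).
Proof.
move=> oU; split.
  by do 2 (apply: openI; last exact: open_setC_pinch).
by move=> [] [[_ /= nt nf]].
Qed.

(** A horizontal band of width one around [tail b n]. Bands of distinct indices are disjoint, and
    all of them stay away from the axis that carries the pinch points. *)
Definition strip b n : set F :=
  [set z | n.+1%:R - 1/2 < sgb b * ycoord z < n.+1%:R + 1/2].

Lemma open_strip b n : open (strip b n : set F).
Proof.
rewrite (_ : strip b n = [set z | 0 < sgb b * ycoord z - (n.+1%:R - 1/2)] `&`
    [set z | 0 < n.+1%:R + 1/2 - sgb b * ycoord z]); last first.
  by apply/seteqP; split=> z /=; rewrite /strip /= !subr_gt0 => /andP.
have := continuous_ycoord => ?.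
by apply: openI; apply: open_coord; solve_continuous.
Qed.

Lemma strip_ge b n z : strip b n z -> 1 / 2 < sgb b * ycoord z.
Proof.
by case/andP=> h _; have := ler1n R n.+1; rewrite ltn0Sn => H; lra.
Qed.

Lemma strip_pinch b b' n : ~ strip b n (pinch b').
Proof. by move=> /strip_ge; rewrite ypinch; lra. Qed.

Lemma strip_tail b n : strip b n (tail b n).
Proof.
rewrite /strip /= ytail mulrA.
rewrite (_ : sgb b * sgb b = 1); last by case: b; rewrite /pinch_sign; lra.
by rewrite mul1r; lra.
Qed.

Lemma strip_inj b m n z : strip b m z -> strip b n z -> m = n.
Proof.
rewrite /strip /= => /andP[h1 h2] /andP[h3 h4].
apply/eqP; rewrite eqn_leq -[(m <= n)%N]ltnS -[(n <= m)%N]ltnS -!(ltr_nat R).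
rewrite -![X in _ < X]natr1; apply/andP; split; lra.
Qed.

Lemma strip_pinched_open b n : open (strip b n : set E).
Proof. by split; [exact: open_strip|move=> b' /strip_pinch]. Qed.

(** A neighborhood of [pinch b] when [W] is one and [P] is cofinite. The bound 1/2 keeps the piece
    cut from [W] disjoint from every strip, and the sign condition on [xcoord] excludes the other
    pinch point, whose tail is not covered. *)
Definition strip_nbhs b (W : set F) (P : set nat) : set F :=
  (W `&` [set z | 0 < 1/2 - sgb b * ycoord z]
     `&` [set z | 0 < sgb b * xcoord z])
  `|` \bigcup_(n in P) strip b n.

Lemma strip_nbhs_open b W P :
  open W -> (exists N, forall n, (N <= n)%N -> P n) ->
  open (strip_nbhs b W P : set E).
Proof.
have := continuous_xcoord; have := continuous_ycoord => cy cx.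
move=> oW [N HN]; split.
  apply: openU; last by apply: bigcup_open => n _; exact: open_strip.
  by do 2?[apply: openI => //]; apply: open_coord; solve_continuous.
move=> b' [[_ /=]|[n _ /strip_pinch//]].
rewrite xpinch => bb'; have -> : b' = b.
  by move: bb'; case: b; case: b' => //=; rewrite /pinch_sign; lra.
by exists N => n /HN Pn; right; exists n => //; exact: strip_tail.
Qed.

(** Only parameters [s0] sent to a pinch point matter. Near [s0] the map stays in
    [strip_nbhs b W setT]; if it entered strip [n], connectedness of a ball around [s0] would put
    the whole ball, hence the pinch point, in that strip. So it stays in [W]. *)
Lemma continuous_punctured_of_pinched (g : R -> E) :
  continuous g -> continuous (g : R -> F).
Proof.
move=> cg s0 A nA.
have [W [oW Ws0 WA]] : exists W : set F, [/\ open W, W (g s0) & W `<=` A].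
  by move: nA; rewrite /= nbhsE => -[W [? ?] ?]; exists W.
suff : \forall s \near s0, W (g s) by apply: filterS => s /WA.
have [[b gs0]|ns0] := pselect (exists b, g s0 = pinch b); last first.
  (* Away from the pinch points [W] itself yields an open set of the pinched topology. *)
  have oW' := open_without_pinch oW.
  have : \forall s \near s0,
      (W `&` ~` [set pinch true] `&` ~` [set pinch false]) (g s).
    apply: cg; apply: open_nbhs_nbhs; split=> //.
    by split; [split=> //|]; move=> e; apply: ns0; eexists; exact: e.
  by apply: filterS => s [[]].
have U0 P : strip_nbhs b W P (pinch b).
  left; rewrite /= -{1}gs0; split; [split=> //|]; rewrite ?xpinch ?ypinch.
    lra.
  by case: b {gs0}; rewrite /pinch_sign /=; lra.
have oU P := @strip_nbhs_open b W P oW.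
have : nbhs s0 (g @^-1` strip_nbhs b W setT).
  apply: cg; apply: open_nbhs_nbhs.
  by split; [apply: oU; exists 0%N|rewrite gs0].
case/nbhs_ballP => d /= d0 dU.
apply/nbhs_ballP; exists d => // s ds.
have [[[//]]|[n _ gsn]] := dU _ ds.
suff : strip b n (g s0) by rewrite gs0 => /strip_pinch.
have cB : connected (ball s0 d).
  by rewrite ball_itv; exact/connected_intervalP/interval_is_interval.
suff : (ball s0 d `&` g @^-1` (strip b n)) s0 by case.
(* The part of the ball sent into strip [n] is nonempty, open and closed. *)
rewrite (_ : _ `&` _ = ball s0 d); first exact: ballxx.
  apply: cB; first by exists s.
    exists (g @^-1` (strip b n)) => //.
    by move/continuousP: cg; apply; exact: strip_pinched_open.
  (* Within the ball, the complement is the preimage of the neighborhood with strip [n] left out,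
     which is still open since it keeps every index above [n]. *)
  exists (~` (g @^-1` (strip_nbhs b W [set m | m != n]))).
    apply: open_closedC; move/continuousP: cg; apply; apply: oU.
    by exists n.+1 => m /gtn_eqF /= ->.
  apply/seteqP; split=> t [dt /= gt]; split=> //=.
    move=> [[[_ /=]]|[m /= /eqP mn /strip_inj/(_ gt)//]].
    by move: (strip_ge gt) => /=; lra.
  have [//|[m _ gm]] := dU _ dt; first by move=> h; case: gt; left.
  by have [<-//|mn] := eqVneq m n; case: gt; right; exists m.
Qed.

End PinchedPlane.

(** * The antipodal covering and its mirror image *)

Section Coverings.
Local Open Scope quotient_scope.
Context {R : realType}.
Local Notation F := (punctured_plane R).
Local Notation E := (pinched_plane R).
Local Notation sgb := (@pinch_sign R).
Local Notation pinch := (@pinch R).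
Local Notation tail := (@tail R).

Definition antipode (z : F) : F := mk_point (- xcoord z) (- ycoord z).
Definition mirror (z : F) : F := mk_point (xcoord z) (- ycoord z).

Lemma xantipode z : xcoord (antipode z) = - xcoord z.
Proof. by rewrite xcoordE // !oppr_eq0; exact: coord_neq0. Qed.

Lemma yantipode z : ycoord (antipode z) = - ycoord z.
Proof. by rewrite ycoordE // !oppr_eq0; exact: coord_neq0. Qed.

Lemma xmirror z : xcoord (mirror z) = xcoord z.
Proof. by rewrite xcoordE // oppr_eq0; exact: coord_neq0. Qed.

Lemma ymirror z : ycoord (mirror z) = - ycoord z.
Proof. by rewrite ycoordE // oppr_eq0; exact: coord_neq0. Qed.

Definition coord_symE := (xantipode, yantipode, xmirror, ymirror).

Lemma antipodeK : involutive antipode.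
Proof. by move=> z; apply: coord_inj; rewrite !coord_symE opprK. Qed.

Lemma mirrorK : involutive mirror.
Proof. by move=> z; apply: coord_inj; rewrite !coord_symE ?opprK. Qed.

Lemma mirror_antipode z : mirror (antipode z) = antipode (mirror z).
Proof. by apply: coord_inj; rewrite !coord_symE. Qed.

Lemma pinch_signN b : sgb (~~ b) = - sgb b.
Proof. by case: b; rewrite /pinch_sign ?opprK. Qed.

Lemma antipode_pinch b : antipode (pinch b) = pinch (~~ b).
Proof.
by apply: coord_inj; rewrite !coord_symE ?xpinch ?ypinch ?oppr0 ?pinch_signN.
Qed.

Lemma antipode_tail b n : antipode (tail b n) = tail (~~ b) n.
Proof.
by apply: coord_inj; rewrite !coord_symE ?xtail ?ytail ?oppr0 ?pinch_signN ?mulNr.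
Qed.

Lemma mirror_pinch b : mirror (pinch b) = pinch b.
Proof. by apply: coord_inj; rewrite !coord_symE ?ypinch ?oppr0. Qed.

Lemma mirror_tail b n : mirror (tail b n) = tail (~~ b) n.
Proof. by apply: coord_inj; rewrite !coord_symE ?xtail ?ytail ?pinch_signN ?mulNr. Qed.

Lemma continuous_antipode : continuous antipode.
Proof.
have := @continuous_xcoord R; have := @continuous_ycoord R => cy cx.
apply: continuous_punctured.
  rewrite (_ : _ \o _ = fun z => - xcoord z); first by solve_continuous.
  by apply/funext => z /=; rewrite coord_symE.
rewrite (_ : _ \o _ = fun z => - ycoord z); first by solve_continuous.
by apply/funext => z /=; rewrite coord_symE.
Qed.

Lemma continuous_mirror : continuous mirror.
Proof.
have := @continuous_xcoord R; have := @continuous_ycoord R => cy cx.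
apply: continuous_punctured.
  rewrite (_ : _ \o _ = fun z => xcoord z); first by [].
  by apply/funext => z /=; rewrite coord_symE.
rewrite (_ : _ \o _ = fun z => - ycoord z); first by solve_continuous.
by apply/funext => z /=; rewrite coord_symE.
Qed.

Lemma continuous_pinched_antipode : continuous (antipode : E -> E).
Proof.
apply/continuousP => U [oU tU]; split.
  by move/continuousP: continuous_antipode; apply.
move=> b; rewrite /= antipode_pinch => /tU[N HN].
by exists N => n /HN; rewrite /= antipode_tail.
Qed.

(** The mirror fixes each pinch point but exchanges the tails. For an antipode-invariant set this is
    harmless, since the antipode exchanges them back. *)
Lemma open_mirror_preimage (U : set E) :
  (forall z, U z -> U (antipode z)) -> open U -> open (mirror @^-1` U : set E).
Proof.
move=> sU [oU tU]; split.
  by move/continuousP: continuous_mirror; apply.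
move=> b; rewrite /= mirror_pinch => /tU[N HN].
by exists N => n /HN/sU; rewrite /= mirror_tail antipode_tail.
Qed.

(** The diagonal boundary is chosen so that each side contains one pinch point together with its
    entire tail. *)
Lemma open_half_plane (b : bool) :
  open [set z : E | 0 < sgb b * (xcoord z + ycoord z)].
Proof.
have := @continuous_xcoord R; have := @continuous_ycoord R => cy cx.
split; first by apply: open_coord; solve_continuous.
move=> b' /=; rewrite xpinch ypinch addr0 => bb'.
have -> : b' = b.
  by move: bb'; case: b b' => -[]; rewrite /pinch_sign //; lra.
exists 0%N => n _; rewrite xtail ytail add0r mulrA.
rewrite (_ : sgb b * sgb b = 1) ?mul1r ?ltr0n //.
by case: b {bb'}; rewrite /pinch_sign; lra.
Qed.

(** Off the diagonal x + y = 0, one of the two open half-planes works. The diagonal contains no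
    pinch point, so there an ordinary half-plane bounded by x = y, stripped of the pinch points, can
    be used. *)
Lemma antipode_disjoint (z : E) :
  exists V : set E, [/\ open V, V z & forall w, V w -> ~ V (antipode w)].
Proof.
have := @continuous_xcoord R; have := @continuous_ycoord R => cy cx.
have [zb|zb|zb] := ltgtP (xcoord z + ycoord z) 0.
- exists [set z : E | 0 < sgb true * (xcoord z + ycoord z)].
  split; [exact: open_half_plane|by rewrite /= /pinch_sign; lra|].
  by move=> w /=; rewrite !coord_symE /pinch_sign; lra.
- exists [set z : E | 0 < sgb false * (xcoord z + ycoord z)].
  split; [exact: open_half_plane|by rewrite /= /pinch_sign; lra|].
  by move=> w /=; rewrite !coord_symE /pinch_sign; lra.
- have zp b : z <> pinch b.
    move=> e; move: zb; rewrite e xpinch ypinch addr0.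
    by apply/eqP/pinch_sign_neq0.
  pose b := xcoord z < 0.
  have oH : open [set z : F | 0 < sgb b * (xcoord z - ycoord z)].
    by apply: open_coord; solve_continuous.
  exists ([set z : E | 0 < sgb b * (xcoord z - ycoord z)]
    `&` ~` [set pinch true] `&` ~` [set pinch false]); split.
  + exact: open_without_pinch.
  + do 2 (split; last exact: zp).
    rewrite /= /b /pinch_sign; case: (ltP (xcoord z) 0) => h; first lra.
    (* On the diagonal the x-coordinate cannot vanish, as [z] is not the origin. *)
    have [x0|y0] := coord_neq0 z.
      have : 0 < xcoord z by rewrite lt_def x0 h.
      lra.
    have x0 : xcoord z != 0.
      by apply: contra y0 => /eqP x0; move: zb; rewrite x0 add0r => ->.
    have : 0 < xcoord z by rewrite lt_def x0 h.
    lra.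
  + move=> w [[/= h _] _] [[/=]]; rewrite !coord_symE.
    by move=> + _ _; move: h; case: b {oH}; rewrite /pinch_sign; lra.
Qed.

Definition antipodal (z w : E) : bool := (z == w) || (z == antipode w).

Lemma antipodal_refl : reflexive antipodal.
Proof. by move=> z; rewrite /antipodal eqxx. Qed.

Lemma antipodal_sym : symmetric antipodal.
Proof.
move=> z w; rewrite /antipodal eq_sym; congr (_ || _).
by apply/eqP/eqP => ->; rewrite antipodeK.
Qed.

Lemma antipodal_trans : transitive antipodal.
Proof.
move=> v u w; rewrite /antipodal => /orP[/eqP->//|/eqP->] /orP[]/eqP->.
  by rewrite eqxx orbT.
by rewrite antipodeK eqxx.
Qed.

Canonical antipodal_rel :=
  EquivRel antipodal antipodal_refl antipodal_sym antipodal_trans.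

Definition antipodal_quotient : Type :=
  quotient_topology {eq_quot antipodal_rel}.

HB.instance Definition _ := Topological.copy antipodal_quotient
  (quotient_topology {eq_quot antipodal_rel}).
Local Notation B := antipodal_quotient.

Definition antipodal_proj (z : E) : B :=
  \pi_(quotient_topology {eq_quot antipodal_rel}) z.

Lemma antipodal_proj_eqP z w :
  antipodal_proj z = antipodal_proj w <-> z = w \/ z = antipode w.
Proof.
rewrite /antipodal_proj; split=> [/eqmodP/orP[]/eqP|h]; [by left|by right|].
by apply/eqmodP; rewrite /= /antipodal; case: h => ->; rewrite eqxx ?orbT.
Qed.

Lemma antipodal_proj_surj (b : B) : exists z, antipodal_proj z = b.
Proof.
by exists (repr (b : quotient_topology {eq_quot antipodal_rel})); exact: reprK.
Qed.

Lemma antipodal_proj_openP (U : set B) :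
  open U <-> open (antipodal_proj @^-1` U).
Proof. by []. Qed.

Lemma continuous_antipodal_proj : continuous antipodal_proj.
Proof. by apply/continuousP. Qed.

HB.instance Definition _ :=
  isContinuous.Build E B antipodal_proj continuous_antipodal_proj.

Definition mirror_proj (z : E) : B := antipodal_proj (mirror z).

Lemma mirror_proj_eqP z w :
  mirror_proj z = mirror_proj w <-> z = w \/ z = antipode w.
Proof.
rewrite antipodal_proj_eqP -mirror_antipode.
by split=> -[] /(congr1 mirror); rewrite ?mirrorK => ->;
  [left|right|left|right].
Qed.

Lemma mirror_proj_surj (b : B) : exists z, mirror_proj z = b.
Proof.
have [z <-] := antipodal_proj_surj b; exists (mirror z).
by rewrite /mirror_proj mirrorK.
Qed.

(** Preimages of subsets of [B] are antipode-invariant, and on such sets the mirror preserves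
    openness in both directions, being an involution. *)
Lemma mirror_proj_openP (U : set B) : open U <-> open (mirror_proj @^-1` U).
Proof.
have symp z : antipodal_proj (antipode z) = antipodal_proj z.
  by apply/antipodal_proj_eqP; right.
split=> [/antipodal_proj_openP oU|oU].
  by apply: (open_mirror_preimage _ oU) => z; rewrite /= symp.
apply/antipodal_proj_openP.
rewrite (_ : _ @^-1` U = mirror @^-1` (mirror_proj @^-1` U)).
  apply: (open_mirror_preimage _ oU) => z.
  by rewrite /= /mirror_proj mirror_antipode symp.
by apply/seteqP; split=> z; rewrite /= /mirror_proj mirrorK.
Qed.

Lemma continuous_mirror_proj : continuous mirror_proj.
Proof. by apply/continuousP => U /mirror_proj_openP. Qed.

HB.instance Definition _ :=
  isContinuous.Build E B mirror_proj continuous_mirror_proj.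

Lemma antipodal_proj_two_fold : two_fold_covering antipodal_proj.
Proof.
exact: (involution_quotient_two_fold continuous_pinched_antipode antipodeK
  antipode_disjoint antipodal_proj_eqP antipodal_proj_surj
  antipodal_proj_openP).
Qed.

Lemma mirror_proj_two_fold : two_fold_covering mirror_proj.
Proof.
exact: (involution_quotient_two_fold continuous_pinched_antipode antipodeK
  antipode_disjoint mirror_proj_eqP mirror_proj_surj mirror_proj_openP).
Qed.

End Coverings.

(** * Paths, induced subgroups and non-equivalence *)

Section Paths.
Context {R : realType}.
Local Notation I := (unit_interval R).
Local Notation F := (punctured_plane R).
Local Notation E := (pinched_plane R).
Local Notation sgb := (@pinch_sign R).
Local Notation pinch := (@pinch R).
Local Notation tail := (@tail R).
Local Notation B := (@antipodal_quotient R).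
Local Notation mirror := (@mirror R).
Local Notation antipode := (@antipode R).

Lemma segment_joined (z w : E) :
  (forall t, 0 <= t <= 1 ->
     (1 - t) * xcoord z + t * xcoord w != 0 \/
     (1 - t) * ycoord z + t * ycoord w != 0) ->
  @path_joined R E z w.
Proof.
move=> nz.
pose g (t : I) : F := mk_point ((1 - uval t) * xcoord z + uval t * xcoord w)
  ((1 - uval t) * ycoord z + uval t * ycoord w).
have nzg t := nz (uval t) (introT andP (conj (uval_ge0 t) (uval_le1 t))).
have cg : continuous g.
  apply: continuous_punctured.
    rewrite (_ : _ \o _ = fun t => (1 - uval t) * xcoord z + uval t * xcoord w).
      by solve_continuous.
    by apply/funext => t; exact: xcoordE.
  rewrite (_ : _ \o _ = fun t => (1 - uval t) * ycoord z + uval t * ycoord w).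
    by solve_continuous.
  by apply/funext => t; exact: ycoordE.
have g0 : g zero = z.
  apply: coord_inj; rewrite ?xcoordE ?ycoordE //;
    by rewrite ?uval0 ?subr0 ?mul1r ?mul0r ?addr0 //; exact: coord_neq0.
have g1 : g one = w.
  apply: coord_inj; rewrite ?xcoordE ?ycoordE //;
    by rewrite ?uval1 ?subrr ?mul1r ?mul0r ?add0r //; exact: coord_neq0.
by constructor; exact: (mk_path (continuous_pinched cg) g0 g1).
Qed.

(** The closed right half-plane without the origin is star-shaped about (1, 0). *)
Lemma joined_pinch_ge0 (z : E) :
  0 <= xcoord z -> @path_joined R E z (pinch false).
Proof.
move=> z0; apply: segment_joined => t /andP[t0 t1].
rewrite xpinch ypinch /pinch_sign.
have [t_0|tn0] := eqVneq t 0.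
  by rewrite t_0 subr0 !mul1r !mul0r !addr0; exact: coord_neq0.
left; rewrite gt_eqF // ltr_wpDl // ?mulr1 ?lt_def ?tn0 //.
by rewrite mulr_ge0 // subr_ge0.
Qed.

Lemma joined_pinch (z : E) : @path_joined R E z (pinch false).
Proof.
have [/joined_pinch_ge0//|z0] := leP 0 (xcoord z).
(* From the left half-plane, a detour through (0, 1) avoids the origin. *)
apply: (path_joined_trans (y := tail false 0 : E)); last first.
  by apply: joined_pinch_ge0; rewrite xtail.
apply: segment_joined => t /andP[t0 t1]; rewrite xtail ytail /pinch_sign.
have [->|tn1] := eqVneq t 1.
  by right; rewrite subrr mul0r add0r !mul1r oner_eq0.
left; rewrite mulr0 addr0 mulf_neq0 ?(lt_eqF z0) // subr_eq0.
by rewrite eq_sym.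
Qed.

Lemma pinched_plane_path_connected : path_connected R E.
Proof.
split; first by exists (pinch false).
move=> z w; apply: (path_joined_trans (joined_pinch z)).
exact: path_joined_sym (joined_pinch w).
Qed.

(** The path is extended to the whole line by [clamp], where balls are intervals and
    [continuous_punctured_of_pinched] applies. *)
Lemma continuous_pinched_path (g : I -> E) :
  continuous g -> continuous (g : I -> F).
Proof.
move=> cg; have cgc : continuous (fun r => g (clamp r) : F).
  apply: continuous_punctured_of_pinched.
  by apply: continuous_comp1 => //; exact: continuous_clamp.
rewrite (_ : g = fun t => g (clamp (uval t))).
  by apply: (continuous_comp1 cgc); exact: continuous_uval.
by apply/funext => t; rewrite uvalK.
Qed.

(** The path is lifted to the finer topology of the punctured plane, where the mirror is continuous,
    and then brought back. *)
Lemma continuous_mirror_path (g : I -> E) :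
  continuous g -> continuous (mirror \o g : I -> E).
Proof.
move=> /continuous_pinched_path cg; apply: continuous_pinched.
by apply: (continuous_comp1 _ cg); exact: continuous_mirror.
Qed.

Section MirrorLoop.
Context (a : {path I from (pinch false : E) to (pinch false : E)}).

Lemma mirror_loop_zero : (mirror \o a) zero = pinch false.
Proof. by rewrite /= path_zero mirror_pinch. Qed.

Lemma mirror_loop_one : (mirror \o a) one = pinch false.
Proof. by rewrite /= path_one mirror_pinch. Qed.

Definition mirror_loop : {path I from (pinch false : E) to (pinch false : E)} :=
  mk_path (continuous_mirror_path (@cts_fun _ _ a))
    mirror_loop_zero mirror_loop_one.

End MirrorLoop.

(** Mirroring a loop turns its image under one projection into its image under the other, so each
    range contains the other. *)
Lemma range_pi1_map_mirror (b0 : B)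
    (pe0 : antipodal_proj (pinch false) = b0)
    (qe0 : mirror_proj (pinch false) = b0) :
  range (pi1_map R pe0) = range (pi1_map R qe0).
Proof.
apply/seteqP; split=> _ [u _ <-].
  exists (loop_class (mirror_loop (loop_repr u))) => //.
  rewrite pi1_mapE -{2}(loop_reprK u) pi1_mapE.
  apply/loop_classP/path_homotopic_eq => t.
  by rewrite /= /mk_path /= /mk_path /mirror_proj /= mirrorK.
exists (loop_class (mirror_loop (loop_repr u))) => //.
rewrite pi1_mapE -{2}(loop_reprK u) pi1_mapE.
by apply/loop_classP/path_homotopic_eq => t.
Qed.

(** The coordinates are not continuous on the pinched plane, but they are along paths. A change of
    sign is therefore excluded by the intermediate value theorem on a path joining two points. *)
Lemma mirror_lift_sign (h : E -> E) : continuous h ->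
  (forall z, h z = mirror z \/ h z = antipode (mirror z)) ->
  exists b : bool, forall z, h z = if b then antipode (mirror z) else mirror z.
Proof.
move=> ch hE.
(* The inner product of [h z] with [mirror z]: plus or minus the squared norm of [z], hence never
   zero. *)
pose d (z : E) := xcoord (h z) * xcoord z - ycoord (h z) * ycoord z.
have nz (z : E) : 0 < xcoord z ^+ 2 + ycoord z ^+ 2.
  rewrite lt_def addr_ge0 ?sqr_ge0 // andbT paddr_eq0 ?sqr_ge0 // !sqrf_eq0.
  apply/andP => -[/eqP x0 /eqP y0].
  by have := coord_neq0 z; rewrite x0 y0 eqxx => -[].
have dmirror z : h z = mirror z -> d z = xcoord z ^+ 2 + ycoord z ^+ 2.
  by rewrite /d => ->; rewrite !coord_symE; lra.
have dantipode z : h z = antipode (mirror z) ->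
    d z = - (xcoord z ^+ 2 + ycoord z ^+ 2).
  by rewrite /d => ->; rewrite !coord_symE; lra.
have d_neq0 z : d z != 0.
  case: (hE z) => [/dmirror->|/dantipode->]; rewrite ?oppr_eq0 gt_eqF //.
have d_gt0 z : h z = mirror z <-> 0 < d z.
  split=> [/dmirror->//|]; case: (hE z) => // /dantipode ->.
  by rewrite oppr_gt0 ltNge ltW.
have path_sign (z w : E) : 0 < d z -> 0 < d w.
  move=> z0; rewrite ltNge; apply/negP => w0.
  have [g] := pinched_plane_path_connected.2 z w.
  pose f (r : R) := d (g (clamp r)).
  have cg : continuous (g : I -> F).
    by apply: continuous_pinched_path; exact: cts_fun.
  have chg : continuous (h \o g : I -> F).
    apply: continuous_pinched_path.
    by apply: continuous_comp1 => //; exact: cts_fun.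
  have := @continuous_xcoord R; have := @continuous_ycoord R => cy cx.
  have cdg : continuous (d \o g).
    have cxg : continuous (fun t => xcoord (g t)).
      exact: (continuous_comp1 cx cg).
    have cyg : continuous (fun t => ycoord (g t)).
      exact: (continuous_comp1 cy cg).
    have cxhg : continuous (fun t => xcoord (h (g t))).
      exact: (continuous_comp1 cx chg).
    have cyhg : continuous (fun t => ycoord (h (g t))).
      exact: (continuous_comp1 cy chg).
    rewrite (_ : d \o g = fun t => xcoord (h (g t)) * xcoord (g t)
      - ycoord (h (g t)) * ycoord (g t)) //.
    by solve_continuous.
  have cf : continuous f by exact: (continuous_comp1 cdg (@continuous_clamp R)).
  have f0 : f 0 = d z by rewrite /f clamp0 path_zero.
  have f1 : f 1 = d w by rewrite /f clamp1 path_one.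
  have [|c _ /eqP] := @IVT R f 0 1 0 ler01 (continuous_subspaceT cf).
    by rewrite f0 f1 ge_min le_max w0 (ltW z0) orbT.
  by apply/negP; exact: d_neq0.
have [hp|hp] := hE (pinch false).
  by exists false => z; apply/d_gt0/path_sign/d_gt0; exact: hp.
exists true => z; case: (hE z) => // /d_gt0 /(path_sign _ (pinch false)).
by rewrite (dantipode _ hp) oppr_gt0 ltNge ltW.
Qed.

Lemma antipodal_mirror_not_equivalent :
  ~ equivalent_coverings (@antipodal_proj R) (@mirror_proj R).
Proof.
case=> h [[ch _] qh].
have [b hb] : exists b : bool,
    forall z, h z = if b then antipode (mirror z) else mirror z.
  apply: mirror_lift_sign => // z.
  have : antipodal_proj (mirror (h z)) = antipodal_proj z.
    exact: (congr1 (fun f => f z) qh).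
  case/antipodal_proj_eqP => /(congr1 mirror); rewrite mirrorK => ->.
    by left.
  by right; exact: mirror_antipode.
(* This half-plane contains [h (pinch false)], which is [pinch b], but [h] sends every point of the
   upper tail to the tail of the other pinch point, outside it. *)
have : open (h @^-1` [set z : E | 0 < sgb b * (xcoord z + ycoord z)]).
  by move/continuousP: ch; apply; exact: open_half_plane.
case=> _ /(_ false)[].
  rewrite /= hb mirror_pinch; case: b {hb}; rewrite ?antipode_pinch;
    by rewrite xpinch ypinch /pinch_sign /=; lra.
move=> N /(_ N (leqnn N)) /=; rewrite hb mirror_tail.
have : 0 < N.+1%:R :> R by rewrite ltr0n.
by case: b {hb}; rewrite ?antipode_tail xtail ytail /pinch_sign /=; lra.
Qed.

End Paths.

Theorem mainTheorem2 (R : realType) :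
  exists (E B : topologicalType) (p q : continuousType E B) (e0 : E) (b0 : B)
      (pe0 : p e0 = b0) (qe0 : q e0 = b0),
    [/\ path_connected R E /\ path_connected R B,
        two_fold_covering p,
        two_fold_covering q,
        range (pi1_map R pe0) = range (pi1_map R qe0) &
        ~ equivalent_coverings p q].
Proof.
(* The base point (1, 0) lies on the axis of the mirror, so both projections agree there. *)
have qe0 : mirror_proj (@pinch R false) = antipodal_proj (@pinch R false).
  by rewrite /mirror_proj mirror_pinch.
exists (pinched_plane R), (@antipodal_quotient R).
exists (@antipodal_proj R : continuousType _ _).
exists (@mirror_proj R : continuousType _ _).
exists (@pinch R false), (antipodal_proj (@pinch R false)), erefl, qe0; split.
- split; first exact: pinched_plane_path_connected.
  apply: (path_connected_image (f := @antipodal_proj R)).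
    exact: antipodal_proj_surj.
  exact: pinched_plane_path_connected.
- exact: antipodal_proj_two_fold.
- exact: mirror_proj_two_fold.
- exact: range_pi1_map_mirror.
- exact: antipodal_mirror_not_equivalent.
Qed.
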